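(* (a) For every $k\in\mathbb N$, the $(k+1)$-ary inclusion, anonymity, and exclusion atoms are not definable in $\mathbb{LE}^U_k$. (b) For every $k\in\mathbb N$, the $(k+1)$-ary dependence atom is not definable in $\mathbb{LF}^U_k$. (c) The $(k,l,m)$-ary independence atom is not definable in $\mathbb{LF}^U_{i}$ if $i<\max(k,l)+m$.
   Context: Models are assumed to have at least two elements. A team $T$ in a model $M$ with domain $\vec x=(x_0,\dots,x_{m-1})$ is a set of assignments from $\vec x$ to $M$, identified with a subset of $M^m$; $T\restriction\vec x=\{s\restriction\vec x:s\in T\}$. Team semantics. For a first-order literal $\phi$: $M\models_T\phi$ iff every $s\in T$ satisfies $\phi$. $M\models_T\phi\wedge\psi$ iff both hold. $M\models_T\phi\vee\psi$ iff $T=U\cup V$ with $M\models_U\phi$, $M\models_V\psi$ for some $U,V$. Tensor conjunction: $M\models_T\phi\wedge_{\mathrm t}\psi$ iff $T=U\cap V$ with $M\models_U\phi$, $M\models_V\psi$ for some $U,V$ (teams with the same domain as $T$). Intuitionistic disjunction: $M\models_T\phi\,\underline{\vee}\,\psi$ iff $M\models_T\phi$ or $M\models_T\psi$. Lindström quantifiers: for each positive integer $r$ and each isomorphism-closed class $\mathcal K$ of structures $(A,R)$, $R\subseteq A^r$: $M\models_T Q_{\mathcal K}\vec y\,\psi$ iff there is $F:T\to\mathcal P(M^r)$ with $M\models_{T[F/\vec y]}\psi$ and $(M,F(s))\in\mathcal K$ for all $s\in T$, where $T[F/\vec y]=\{s(\vec b/\vec y):s\in T,\vec b\in F(s)\}$.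 Atoms. Dependence ($k$-ary if $\mathrm{len}(\vec x)=k$): $M\models_T{=}(\vec x,y)$ iff $s(\vec x)=s'(\vec x)$ implies $s(y)=s'(y)$ for all $s,s'\in T$. Exclusion ($k$-ary if $\mathrm{len}(\vec x)=\mathrm{len}(\vec y)=k>0$): $M\models_T\vec x\mid\vec y$ iff $s(\vec x)\neq s'(\vec y)$ for all $s,s'\in T$. Inclusion (same arity convention): $M\models_T\vec x\subseteq\vec y$ iff for every $s\in T$ there is $s'\in T$ with $s(\vec x)=s'(\vec y)$. Anonymity ($k$-ary if $\mathrm{len}(\vec x)=k>0$): $M\models_T\vec x\,\Upsilon\,y$ iff for every $s\in T$ there is $s'\in T$ with $s(\vec x)=s'(\vec x)$, $s(y)\ne s'(y)$. Independence: $M\models_T\vec t_2\perp_{\vec t_1}\vec t_3$ iff for all $s,s'\in T$ with $s(\vec t_1)=s'(\vec t_1)$ there is $s''\in T$ with $s''(\vec t_1)=s(\vec t_1)$, $s''(\vec t_2)=s(\vec t_2)$, $s''(\vec t_3)=s'(\vec t_3)$; it is $(k,l,m)$-ary if $\mathrm{len}(\vec t_1)=m\ge0$, $\mathrm{len}(\vec t_2)=k\ge1$, $\mathrm{len}(\vec t_3)=l\ge1$. General atom: for an isomorphism-closed class $C$ of pairs $(A,S)$ with $S\subseteq A^j$, $M\models_T\alpha_C(\vec x)$ iff $(A,T\restriction\vec x)\in C$, where $A$ is the domain of $M$. Upper dimension. $[A,B]=\{C: A\subseteq C\subseteq B\}$. A family of sets $\mathcal A$ is convex if $[S,T]\subseteq\mathcal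 A$ for all $S,T\in\mathcal A$, and dominated if $\bigcup\mathcal A\in\mathcal A$. A subfamily $\mathcal G\subseteq\mathcal A$ dominates $\mathcal A$ if there are dominated convex families $\mathcal D_G$ ($G\in\mathcal G$) with $\bigcup_{G\in\mathcal G}\mathcal D_G=\mathcal A$ and $\bigcup\mathcal D_G=G$ for each $G$; $\mathrm D(\mathcal A)=\min\{|\mathcal G|:\mathcal G\text{ dominates }\mathcal A\}$. For a formula $\phi$ with free variables in $\vec x$ of length $m$, $\|\phi\|^{M,\vec x}=\{T\subseteq M^m: M\models_T\phi\}$ and the upper dimension function is $\mathrm{Dim}_{\phi,\vec x}(n)=\sup\{\mathrm D(\|\phi\|^{M,\vec x}): |M|=n\}$. Growth classes. $\mathbb E_k$ is the class of $f:\mathbb N\to\mathbb N$ such that for some polynomial $p$ of degree $k$ with coefficients in $\mathbb N$, $f(n)\le 2^{p(n)}$ for all $n\in\mathbb N$. $\mathbb F_k$ is the class of $f:\mathbb N\to\mathbb N$ such that for some polynomial $p$ of degree $k$ with coefficients in $\mathbb N$, $f(n)\le n^{p(n)}$ for all $n\ge2$. $\mathbb{LE}^U_k$ is the closure of literals and all atoms (arbitrary general atoms, which include all the atoms above) whose upper dimension function, with respect to the variables of the atom, is in $\mathbb E_k$, under the connectives $\wedge,\underline{\vee},\vee,\wedge_{\mathrm t}$ and all Lindström quantifiers. $\mathbb{LF}^U_k$ is defined likewise with $\mathbb F_k$ in place of $\mathbb E_k$. An atom $\alpha$ (with pairwise distinct variables $\vec z$) is definable in a logic if the logic has a formula $\phi$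 with free variables in $\vec z$ such that $M\models_T\alpha\iff M\models_T\phi$ for all models $M$ and teams $T$ in $M$ with domain $\vec z$. *)

(* Defs.v *)
From mathcomp Require Import all_boot all_order all_algebra finmap.
From mathcomp Require Import boolp classical_sets functions cardinality.

Set Implicit Arguments.
Unset Strict Implicit.
Unset Printing Implicit Defensive.

Local Open Scope classical_set_scope.
Local Open Scope card_scope.

(** * Upper dimension of a family of sets *)

Definition interval_set {X : Type} (A B : set X) : set (set X) :=
  [set C | A `<=` C /\ C `<=` B].

Definition convex_family {X : Type} (A : set (set X)) : Prop :=
  forall S T, A S -> A T -> interval_set S T `<=` A.

Definition dominated_family {X : Type} (A : set (set X)) : Prop :=
  A (\bigcup_(S in A) S).

Definition dominates {X : Type} (G A : set (set X)) : Prop :=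
  G `<=` A /\
  exists D : set X -> set (set X),
    [/\ forall S, G S -> convex_family (D S) /\ dominated_family (D S),
        \bigcup_(S in G) D S = A
      & forall S, G S -> \bigcup_(U in D S) U = S].

(* A natural number, which is the intended cardinal as soon as some finite
   subfamily dominates A (otherwise 0 by default). Below it is only applied
   over finite models, where A is finite and dominates itself. *)
Definition upper_dim {X : Type} (A : set (set X)) : nat :=
  infimum 0%N [set d | exists2 G, dominates G A & G #= `I_d].

(** * Growth classes *)

Definition growthE (k : nat) : set (nat -> nat) :=
  [set f | exists2 p : {poly nat}, size p = k.+1
           & forall n : nat, f n <= 2 ^ p.[n]%R].

Definition growthF (k : nat) : set (nat -> nat) :=
  [set f | exists2 p : {poly nat}, size p = k.+1
           & forall n : nat, 2 <= n -> f n <= n ^ p.[n]%R].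

(** * Structures, assignments and teams *)

(* Isomorphism-closed classes of structures (A, R) with R a j-ary relation. *)
Record iso_class (j : nat) := IsoClass {
  in_class :> forall A : Type, set (j.-tuple A) -> Prop;
  in_class_iso : forall (A B : Type) (f : A -> B) (R : set (j.-tuple A)),
    bijective f -> in_class R -> in_class [set map_tuple f t | t in R] }.

Record vocabulary := Vocabulary {
  rel_sym : Type;
  rel_ar : rel_sym -> nat;
  fun_sym : Type;
  fun_ar : fun_sym -> nat }.

Record model (L : vocabulary) := Model {
  carrier :> Type;
  rel_int : forall R : rel_sym L, set ((rel_ar R).-tuple carrier);
  fun_int : forall f : fun_sym L, (fun_ar f).-tuple carrier -> carrier;
  two_elements : exists a b : carrier, a <> b }.

(* Variables are natural numbers; an assignment is a finite partial map. *)
Definition assignment (A : Type) := {fmap nat -> A}.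

Definition team (A : Type) := set (assignment A).

Definition team_on {A : Type} (D : {fset nat}) (T : team A) : Prop :=
  forall s, T s -> domf s = D.

(* s(xs), which is free of None when xs lies in the domain of s. *)
Definition values {A : Type} (s : assignment A) (xs : seq nat) : seq (option A) :=
  [seq fnd s x | x <- xs].

Definition team_rel {A : Type} (j : nat) (T : team A) (xs : j.-tuple nat) :
    set (j.-tuple A) :=
  [set a | exists2 s, T s & values s xs = map some a].

(* s(bs/ys): the values of s at variables of ys, if any, are overwritten. *)
Definition update {A : Type} (s : assignment A) (ys : seq nat) (bs : seq A) :
    assignment A :=
  foldr (fun p s' => setf s' p.1 p.2) s (zip ys bs).

Definition extend {A : Type} (r : nat) (T : team A)
    (F : assignment A -> set (r.-tuple A)) (ys : r.-tuple nat) : team A :=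
  [set s' | exists2 s, T s & exists2 b, F s b & s' = update s ys b].

(** * Syntax *)

Inductive term (L : vocabulary) : Type :=
| Var of nat
| App (f : fun_sym L) (ts : 'I_(fun_ar f) -> term L).

Inductive formula (L : vocabulary) : Type :=
| Eq of term L & term L
| Neq of term L & term L
| Rel (R : rel_sym L) (ts : 'I_(rel_ar R) -> term L)
| NRel (R : rel_sym L) (ts : 'I_(rel_ar R) -> term L)
| Atom (j : nat) (C : iso_class j) (xs : j.-tuple nat)
| And of formula L & formula L
| Or of formula L & formula L
| Tensor of formula L & formula L
| IOr of formula L & formula L
| Quant (r : nat) (K : iso_class r.+1) (ys : r.+1.-tuple nat) of
    uniq ys & formula L.

Fixpoint term_vars (L : vocabulary) (t : term L) : {fset nat} :=
  match t with
  | Var x => [fset x]%fset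
  | App _ ts => \big[fsetU/fset0]_i term_vars (ts i)
  end.

Definition args_vars (L : vocabulary) (n : nat) (ts : 'I_n -> term L) :
    {fset nat} :=
  \big[fsetU/fset0]_i term_vars (ts i).

Fixpoint free_vars (L : vocabulary) (phi : formula L) : {fset nat} :=
  match phi with
  | Eq t u | Neq t u => (term_vars t `|` term_vars u)%fset
  | Rel _ ts | NRel _ ts => args_vars ts
  | Atom _ _ xs => [fset x in (xs : seq nat)]%fset
  | And p q | Or p q | Tensor p q | IOr p q =>
      (free_vars p `|` free_vars q)%fset
  | Quant _ _ ys _ p => (free_vars p `\` [fset y in (ys : seq nat)])%fset
  end.

(** * Team semantics *)

(* The singleton of the value of t under s (empty if s is undefined at some
   variable of t). *)
Fixpoint term_val (L : vocabulary) (M : model L) (s : assignment M)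
    (t : term L) : set M :=
  match t with
  | Var x => [set a | fnd s x = Some a]
  | App f ts => [set b | exists2 a : (fun_ar f).-tuple M,
                   forall i, term_val s (ts i) (tnth a i) & b = fun_int a]
  end.

Definition args_val (L : vocabulary) (M : model L) (s : assignment M)
    (n : nat) (ts : 'I_n -> term L) : set (n.-tuple M) :=
  [set a | forall i, term_val s (ts i) (tnth a i)].

(* sat D phi T: the team T, of domain D, satisfies phi in M. The domain is
   explicit because the empty team has every domain. *)
Fixpoint sat (L : vocabulary) (M : model L) (D : {fset nat}) (phi : formula L)
    (T : team M) : Prop :=
  match phi with
  | Eq t u => forall s, T s ->
      exists a b, [/\ term_val s t a, term_val s u b & a = b]
  | Neq t u => forall s, T s ->
      exists a b, [/\ term_val s t a, term_val s u b & a <> b]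
  | Rel R ts => forall s, T s -> exists2 a, args_val s ts a & rel_int a
  | NRel R ts => forall s, T s -> exists2 a, args_val s ts a & ~ rel_int a
  | Atom _ C xs => C M (team_rel T xs)
  | And p q => sat D p T /\ sat D q T
  | Or p q => exists U V : team M, [/\ T = U `|` V, sat D p U & sat D q V]
  | Tensor p q => exists U V : team M,
      [/\ team_on D U /\ team_on D V, T = U `&` V, sat D p U & sat D q V]
  | IOr p q => sat D p T \/ sat D q T
  | Quant r K ys _ p => exists F : assignment M -> set (r.+1.-tuple M),
      sat (D `|` [fset y in (ys : seq nat)])%fset p (extend T F ys) /\
      forall s, T s -> K M (F s)
  end.

Definition team_family (L : vocabulary) (M : model L) (D : {fset nat})
    (phi : formula L) : set (team M) :=
  [set T | team_on D T /\ sat D phi T].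

Arguments team_family {L} M D phi _.

Definition Dim (L : vocabulary) (phi : formula L) (D : {fset nat}) (n : nat) :
    nat :=
  supremum 0%N [set d | exists2 M : model L, [set: M] #= `I_n
                        & d = upper_dim (team_family M D phi)].

(** * Logics and definability *)

Inductive logic_upper (G : set (nat -> nat)) (L : vocabulary) :
    formula L -> Prop :=
| lu_eq t u : logic_upper G (Eq t u)
| lu_neq t u : logic_upper G (Neq t u)
| lu_rel R ts : logic_upper G (@Rel L R ts)
| lu_nrel R ts : logic_upper G (@NRel L R ts)
| lu_atom j (C : iso_class j) (xs : j.-tuple nat) :
    G (Dim (Atom L C xs) [fset x in (xs : seq nat)]%fset) ->
    logic_upper G (Atom L C xs)
| lu_and p q : logic_upper G p -> logic_upper G q -> logic_upper G (And p q)
| lu_or p q : logic_upper G p -> logic_upper G q -> logic_upper G (Or p q)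
| lu_tensor p q :
    logic_upper G p -> logic_upper G q -> logic_upper G (Tensor p q)
| lu_ior p q : logic_upper G p -> logic_upper G q -> logic_upper G (IOr p q)
| lu_quant r (K : iso_class r.+1) (ys : r.+1.-tuple nat) (Uys : uniq ys) p :
    logic_upper G p -> logic_upper G (Quant K Uys p).

Definition LEU (k : nat) (L : vocabulary) : formula L -> Prop :=
  @logic_upper (growthE k) L.

Definition LFU (k : nat) (L : vocabulary) : formula L -> Prop :=
  @logic_upper (growthF k) L.

Definition definable (L : vocabulary) (logic : formula L -> Prop)
    (zs : seq nat) (alpha : forall A : Type, team A -> Prop) : Prop :=
  exists phi : formula L,
    [/\ logic phi,
        (free_vars phi `<=` [fset z in zs])%fset
      & forall (M : model L) (T : team M), team_on [fset z in zs]%fset T ->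
          (alpha M T <-> sat [fset z in zs]%fset phi T)].

(** * Atoms *)

Definition dependence (xs : seq nat) (y : nat) (A : Type) (T : team A) : Prop :=
  forall s s', T s -> T s' -> values s xs = values s' xs -> fnd s y = fnd s' y.

Definition exclusion (xs ys : seq nat) (A : Type) (T : team A) : Prop :=
  forall s s', T s -> T s' -> values s xs <> values s' ys.

Definition inclusion (xs ys : seq nat) (A : Type) (T : team A) : Prop :=
  forall s, T s -> exists2 s', T s' & values s xs = values s' ys.

Definition anonymity (xs : seq nat) (y : nat) (A : Type) (T : team A) : Prop :=
  forall s, T s ->
    exists2 s', T s' & values s xs = values s' xs /\ fnd s y <> fnd s' y.

(* The atom t2 _|_{t1} t3. *)
Definition independence (t2 t1 t3 : seq nat) (A : Type) (T : team A) : Prop :=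
  forall s s', T s -> T s' -> values s t1 = values s' t1 ->
    exists2 s'', T s'' & [/\ values s'' t1 = values s t1,
                             values s'' t2 = values s t2
                           & values s'' t3 = values s' t3].

(* Main.v *)
Require Import Defs.
From mathcomp Require Import all_boot all_order all_algebra finmap zify.
From mathcomp Require Import boolp classical_sets cardinality.

(** A formula of the logic has small upper dimension, while each of the atoms
    has large upper dimension; both bounds concern the number of dominated
    convex families needed to cover the family of teams satisfying a formula.

    Upper bound ([coverable_logic_upper]). Every connective and every Lindstrom
    quantifier acts on families of teams as an operator which distributes over
    unions of families and sends dominated convex families to families which
    are dominated convex or empty ([dc_familyI], [dc_family_setU],
    [dc_family_setI], [dc_family_extend]). Hence the numbers of families needed
    multiply under the two conjunctions and the disjunction, add under the
    intuitionistic disjunction, and do not grow under a quantifier; one family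
    is enough for a literal. Passing from the variables of an atom to a larger
    domain does not increase the number either ([coverable_atom]). Since
    2 <= n, the bounds 2 ^ p(n) and n ^ p(n) with p of degree k are absorbed in
    b(n) ^ (c * n ^ k) with b(n) = 2, respectively b(n) = n, and this shape is
    stable under sums and products.

    Lower bound ([fooling_leq]). If S and T lie in one dominated convex family
    included in A, then A contains the intervals from S and from T up to their
    union. So pairwise distinct members S_i of A, such that for i <> j one of
    the two intervals below S_i `|` S_j leaves A, need distinct families. With n
    the size of the model and P a set of tuples:
    - exclusion: the product of P and its complement, where P contains a fixed
      tuple p0 and avoids a fixed tuple p1;
    - inclusion: the product of P with itself, where P contains p0;
    - anonymity: the product of P with the whole model;
    - dependence: the graphs of functions, which are n ^ (n ^ k) many for
      the k-ary atom;
    - independence of t2 and t3 given t1: the teams whose values at t1 ++ t2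
      form a given set containing (c, p0) for each c, all values being allowed
      at t3; symmetrically in t2 and t3.
    Apart from dependence, there are about 2 ^ (n ^ d) of these teams, where d
    is the length of the tuples in P. For n large this exceeds the upper
    bound. *)

Set Implicit Arguments.
Unset Strict Implicit.
Unset Printing Implicit Defensive.

Local Open Scope classical_set_scope.
Local Open Scope card_scope.

(** * Families that are dominated convex or empty *)

(** The families that are empty, or both convex and dominated, described by a
    single closure condition: a set lying between a member and the union of
    the family is a member. *)
Definition dc_family {X : Type} (A : set (set X)) : Prop :=
  forall S C, A S -> S `<=` C -> C `<=` \bigcup_(T in A) T -> A C.

Lemma dc_familyP {X : Type} (A : set (set X)) : A !=set0 ->
  dc_family A <-> convex_family A /\ dominated_family A.
Proof.
move=> [S0 AS0]; split=> [dcA|[cA dA] S C AS SC CA]; last exact: (cA S _ AS dA).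
split; first by move=> S T AS AT C [SC CT]; apply: (dcA _ _ AS SC) => x /CT Tx; exists T.
by apply: (dcA S0) => // x Sx; exists S0.
Qed.

Lemma dc_family_powerset {X : Type} (P : set X) : dc_family [set T | T `<=` P].
Proof. by move=> S C _ _ CP x /CP [T TP /TP]. Qed.

(** * Covers by dominated convex families *)

(** [coverable N A]: A is the union of at most N families that are dominated
    convex or empty. For finite A this says that the upper dimension of A is at
    most N; the empty families allowed here can be dropped from a cover. *)
Definition coverable {X : Type} (N : nat) (A : set (set X)) : Prop :=
  exists (I : finType) (D : I -> set (set X)),
    [/\ #|I| <= N, forall i, dc_family (D i) & A = \bigcup_i D i].

Lemma coverableW {X : Type} (M N : nat) (A : set (set X)) :
  M <= N -> coverable M A -> coverable N A.
Proof. by move=> MN [I [D [IM dD AD]]]; exists I, D; split=> //; apply: leq_trans MN. Qed.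

Lemma coverable_dc {X : Type} (A : set (set X)) : dc_family A -> coverable 1 A.
Proof.
move=> dA; exists unit, (fun=> A); split=> //; first by rewrite card_unit.
by apply/seteqP; split=> [S AS|S [] //]; exists tt.
Qed.

Lemma coverableU {X : Type} (M N : nat) (A B : set (set X)) :
  coverable M A -> coverable N B -> coverable (M + N) (A `|` B).
Proof.
move=> [I [D [IM dD ->]]] [J [E [JN dE ->]]].
exists (I + J)%type, (fun k => match k with inl i => D i | inr j => E j end).
split; [by rewrite card_sum leq_add | by case |].
apply/seteqP; split=> S.
  by case=> -[i _ iS]; [exists (inl i) | exists (inr i)].
by case=> -[i|j] _ iS; [left; exists i | right; exists j].
Qed.

(** The operator on families given by a relation between a set and a set of
    the argument family; [kripke2] is its binary version. Such operators
    distribute over unions of families. *)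
Definition kripke1 {X Y : Type} (R : set Y -> set X -> Prop) (A : set (set X)) :
    set (set Y) := [set T | exists2 U, A U & R T U].

Definition kripke2 {X Y Z : Type} (R : set Z -> set X -> set Y -> Prop)
    (A : set (set X)) (B : set (set Y)) : set (set Z) :=
  [set T | exists U V, [/\ A U, B V & R T U V]].

Lemma coverable_kripke1 {X Y : Type} (R : set Y -> set X -> Prop) N A :
  (forall D, dc_family D -> dc_family (kripke1 R D)) ->
  coverable N A -> coverable N (kripke1 R A).
Proof.
move=> dR [I [D [IN dD ->]]]; exists I, (fun i => kripke1 R (D i)).
split=> // [i|]; first exact: dR.
apply/seteqP; split=> T.
  by case=> U [i _ iU] TU; exists i => //; exists U.
by case=> i _ [U iU TU]; exists U => //; exists i.
Qed.

Lemma coverable_kripke2 {X Y Z : Type} (R : set Z -> set X -> set Y -> Prop)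
    M N A B :
  (forall D E, dc_family D -> dc_family E -> dc_family (kripke2 R D E)) ->
  coverable M A -> coverable N B -> coverable (M * N) (kripke2 R A B).
Proof.
move=> dR [I [D [IM dD ->]]] [J [E [JN dE ->]]].
exists (I * J)%type, (fun k => kripke2 R (D k.1) (E k.2)).
split=> [|k|]; [by rewrite card_prod leq_mul | exact: dR |].
apply/seteqP; split=> T.
  by case=> U [V [[i _ iU] [j _ jV] TUV]]; exists (i, j) => //; exists U, V.
by case=> -[i j] _ [U [V [iU jV TUV]]]; exists U, V; split=> //; [exists i | exists j].
Qed.

(** * Preservation by the connectives *)

Lemma dc_familyI {X : Type} (A B : set (set X)) :
  dc_family A -> dc_family B ->
  dc_family (kripke2 (fun T U V => T = U /\ T = V) A B).
Proof.
move=> dA dB T C [U [V [AU BV [TU TV]]]] TC CAB; subst U V.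
exists C, C; split=> //.
  by apply: (dA _ _ AU TC) => x /CAB [S [U [V [AU' _ [SU _]]]] Sx]; exists U => //; rewrite -SU.
by apply: (dB _ _ BV TC) => x /CAB [S [U [V [_ BV' [_ SV]]]] Sx]; exists V => //; rewrite -SV.
Qed.

Lemma dc_family_setU {X : Type} (A B : set (set X)) :
  dc_family A -> dc_family B ->
  dc_family (kripke2 (fun T U V => T = U `|` V) A B).
Proof.
move=> dA dB _ C [U [V [AU BV ->]]] UVC CAB.
(* The part of C below the union of A contains U, hence is in A; similarly
   for B. *)
exists (C `&` \bigcup_(T in A) T), (C `&` \bigcup_(T in B) T); split.
- apply: (dA _ _ AU); last exact: subIsetr.
  by move=> x Ux; split; [apply: UVC; left | exists U].
- apply: (dB _ _ BV); last exact: subIsetr.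
  by move=> x Vx; split; [apply: UVC; right | exists V].
rewrite -setIUr; apply/esym/setIidPl => x /CAB [_ [U' [V' [AU' BV' ->]]]].
by case=> [U'x|V'x]; [left; exists U' | right; exists V'].
Qed.

Lemma dc_family_setI {X : Type} (A B : set (set X)) :
  dc_family A -> dc_family B ->
  dc_family (kripke2 (fun T U V => T = U `&` V) A B).
Proof.
move=> dA dB _ C [U [V [AU BV ->]]] UVC CAB.
exists (U `|` C), (V `|` C); split.
- apply: (dA _ _ AU); first exact: subsetUl.
  move=> x [Ux|/CAB [_ [U' [V' [AU' _ ->]]] [U'x _]]]; first by exists U.
  by exists U'.
- apply: (dB _ _ BV); first exact: subsetUl.
  move=> x [Vx|/CAB [_ [U' [V' [_ BV' ->]]] [_ V'x]]]; first by exists V.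
  by exists V'.
by rewrite -setUIl setUC; apply/esym/setUidPl.
Qed.

(** A family whose members are distinguished by codes in a finite type is a
    union of singletons and empty families indexed by the codes. *)
Lemma coverable_injective {X I : Type} (J : finType) (A : set (set X))
    (code : set X -> J) :
  (forall S T, A S -> A T -> code S = code T -> S = T) -> coverable #|J| A.
Proof.
move=> inj; exists J, (fun j => [set S | A S /\ code S = j]); split=> //.
  move=> j S C [AS <-] SC Cj; suff -> : C = S by [].
  apply/seteqP; split=> // x /Cj [T [AT codeT] Tx].
  by rewrite -(inj _ _ AT AS codeT).
by apply/seteqP; split=> [S AS|S [j _ [] //]]; exists (code S).
Qed.

(** * Fooling families *)

(** Two members of A in the same part of a cover have their union below the
    union of that part, so both intervals up to their union stay in A. *)
Lemma fooling_leq {X : Type} (N : nat) (A : set (set X)) (I : finType)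
    (S : I -> set X) :
  coverable N A -> (forall i, A (S i)) ->
  (forall i j, interval_set (S i) (S i `|` S j) `<=` A ->
     interval_set (S j) (S i `|` S j) `<=` A -> i = j) ->
  #|I| <= N.
Proof.
move=> [J [D [JN dD ->]]] AS inj; apply: leq_trans JN.
have /choice [c Dc] i : exists j, D j (S i).
  by have [j _ jS] := AS i; exists j.
apply: (leq_card c) => i j cij.
have Dj : D (c i) (S j) by rewrite cij.
have sub U : U `<=` S i `|` S j -> U `<=` \bigcup_(T in D (c i)) T.
  by move=> Uij x /Uij [ix|jx]; [exists (S i) | exists (S j)].
apply: inj => U [SU /sub UT]; exists (c i) => //.
- exact: dD (Dc i) SU UT.
- exact: dD Dj SU UT.
Qed.

(** The fooling families used below are indexed by the subsets of a set Z; by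
    symmetry it is enough to separate P from Q when Q is not included in P. *)
Lemma fooling_subsets {X : Type} (N : nat) (A : set (set X)) (Y : finType)
    (Z : {set Y}) (S : {set Y} -> set X) :
  coverable N A ->
  (forall P : {set Y}, P \subset Z -> A (S P)) ->
  (forall (P Q : {set Y}) y, P \subset Z -> Q \subset Z ->
     y \in Q -> y \notin P -> ~ (interval_set (S P) (S P `|` S Q) `<=` A)) ->
  2 ^ #|Z| <= N.
Proof.
move=> covA AS sep; rewrite -card_powerset -card_sig.
pose I := {P | P \in powerset Z}.
apply: (@fooling_leq _ _ _ I (fun P => S (val P)) covA).
  by case=> P /= PZ; apply: AS; rewrite -powersetE.
move=> [P PZ] [Q QZ] /= PQ QP; apply: val_inj => /=; move: (PZ) (QZ).
rewrite !powersetE => {}PZ {}QZ; apply/eqP; rewrite finset.eqEsubset; apply/andP.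
split; apply/fintype.subsetP => y yP; apply/negPn/negP => yQ.
  by apply: sep QZ PZ yP yQ _; rewrite setUC.
by apply: sep PZ QZ yP yQ _.
Qed.

(** * Comparison with the upper dimension *)

Lemma dominates_coverable {X : Type} (A G : set (set X)) d :
  dominates G A -> G #= `I_d -> coverable d A.
Proof.
move=> [GA [D [cdD <- topD]]] /card_esym /card_set_bijP [h [hG _ hs]].
exists 'I_d, (fun i : 'I_d => D (h i)); split=> [|i|]; first by rewrite card_ord.
  have Gi : G (h i) by apply: hG => /=.
  move=> S C DS SC; rewrite topD // => Ch.
  have [cD dD] := cdD _ Gi.
  by apply: (cD S _ DS dD); split=> //; rewrite topD.
apply/seteqP; split=> [S [T GT DS]|S [i _ DS]]; last by exists (h i) => //; apply: hG => /=.
by have [i id hi] := hs _ GT; exists (Ordinal id) => //=; rewrite hi.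
Qed.

Lemma coverable_dominates {X : Type} (A : set (set X)) N :
  coverable N A -> exists G d, [/\ dominates G A, G #= `I_d & d <= N].
Proof.
move=> [I [D [IN dD AD]]].
(* Parts of the cover with the same union are merged into one family, so that
   the families are indexed by their unions, as required. *)
pose top i := \bigcup_(T in D i) T.
pose G := top @` [set i | D i !=set0].
have [d Gd] : finite_set G by apply: finite_image; apply: finite_finset.
exists G, d; split=> //; last first.
  rewrite -card_le_II -(card_le_eql Gd); apply: card_le_trans (card_image_le _ _) _.
  apply: card_le_trans (subset_card_le (@subsetT _ _)) _.
  have inj : {in [set: I] &, injective (fun i : I => enum_rank i : nat)}.
    by move=> i j _ _ /val_inj /enum_rank_inj.
  rewrite -(card_le_eql (inj_card_eq inj)); apply: subset_card_le => _ [i _ <-].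
  exact: leq_trans (ltn_ord _) IN.
have dcG S : G S -> dc_family [set U | exists2 i, D i U & top i = S] /\
    \bigcup_(U in [set U | exists2 i, D i U & top i = S]) U = S.
  move=> [i _ <-].
  have E : \bigcup_(U in [set U | exists2 j, D j U & top j = top i]) U = top i.
    apply/seteqP; split=> [x [U [j jU <-]] Ux|x [U iU Ux]]; first by exists U.
    by exists U => //; exists i.
  split=> // U C [j jU ji] UC; rewrite E -ji => Cj.
  by exists j => //; exact: dD jU UC Cj.
split.
  move=> _ [i [S iS] <-]; rewrite AD; exists i => //.
  by apply: (dD _ _ _ iS) => // x Sx; exists S.
exists (fun S => [set U | exists2 i, D i U & top i = S]); split.
- move=> S GS; have [dcS _] := dcG S GS; apply/dc_familyP => //.
  by case: GS => i [U iU] iS; exists U, i.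
- rewrite AD; apply/seteqP; split=> [U [S _ [i iU _]]|U [i _ iU]]; first by exists i.
  by exists (top i); [exists i => //; exists U | exists i].
- by move=> S /dcG [].
Qed.

Lemma infimum_nat (A : set nat) : A !=set0 ->
  A (infimum 0%N A) /\ forall d, A d -> infimum 0%N A <= d.
Proof.
move=> [a Aa].
have exA : exists n, `[< A n >] by exists a; apply/asboolP.
case: (ex_minnP exA) => n /asboolP An minn.
suff -> : infimum 0%N A = n.
  by split=> // d Ad; apply: minn; apply/asboolP.
rewrite /infimum ifF; last by apply/negbTE/set0P; exists a.
apply: xget_subset1; last exact: is_subset1_infimums.
split=> [d Ad|d lbd]; last exact: lbd.
by rewrite leEnat; apply: minn; apply/asboolP.
Qed.

Lemma upper_dim_coverable {X : Type} N (A : set (set X)) :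
  coverable N A -> coverable (upper_dim A) A /\ upper_dim A <= N.
Proof.
move=> /coverable_dominates [G [d [domG Gd dN]]].
have [|[H domH Hd] le_inf] := @infimum_nat [set d | exists2 G, dominates G A & G #= `I_d].
  by exists d, G.
split; first exact: dominates_coverable domH Hd.
by apply: leq_trans (le_inf d _) dN; exists G.
Qed.

Lemma ge_supremum_nat (A : set nat) (N a : nat) :
  (forall d, A d -> d <= N) -> A a -> a <= supremum 0%N A.
Proof.
move=> AN Aa; rewrite -leEnat; apply: ge_supremum_Nmem Aa.
by apply: nat_supremums_neq0; exists N => d /AN.
Qed.

(** * Upper dimension of atoms over a larger domain *)

(** This crude bound depends only on the size of the model. It ensures that the
    supremum defining [Dim] is taken over a bounded set. *)
Lemma coverable_team_family {A : Type} (D : {fset nat}) n (F : set (team A)) :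
  [set: A] #= `I_n -> (forall T, F T -> team_on D T) ->
  coverable #|{set {ffun D -> option 'I_n}}| F.
Proof.
move=> /card_set_bijP [f [fI finj _]] FD.
pose g a : 'I_n := Ordinal (fI a I).
have ginj : injective g.
  by move=> a b [] E; apply: finj => //; exact: in_setT.
pose code (s : assignment A) : {ffun D -> option 'I_n} :=
  [ffun x => omap g (fnd s (val x))].
have codeI s s' : domf s = D -> domf s' = D -> code s = code s' -> s = s'.
  move=> sD s'D /ffunP E; apply/fmapP => x.
  have [xD|xD] := boolP (x \in D); last first.
    have xs : x \notin domf s by rewrite sD.
    have xs' : x \notin domf s' by rewrite s'D.
    by rewrite (not_fnd xs) (not_fnd xs').
  have := E [` xD]%fset; rewrite !ffunE /=.
  by case: (fnd s x) (fnd s' x) => [a|] [b|] // /Some_inj /ginj ->.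
apply: (@coverable_injective _ unit _ _
  (fun T : team A => [set u | `[< exists2 s, T s & code s = u >]]%SET)).
have sub S T : F S -> F T ->
    [set u | `[< exists2 s, S s & code s = u >]]%SET =
    [set u | `[< exists2 s, T s & code s = u >]]%SET -> S `<=` T.
  move=> /FD SD /FD TD /setP E s Ss; have := E (code s); rewrite !inE => Es.
  have /asboolP [s' Ts' /codeI s's] : `[< exists2 s', T s' & code s' = code s >].
    by rewrite -Es; apply/asboolP; exists s.
  by rewrite -(s's (TD _ Ts') (SD _ Ss)).
move=> S T FS FT E; apply/seteqP; split; first exact: sub E.
exact: sub (esym E).
Qed.

Lemma upper_dim_le_Dim (L : vocabulary) (M : model L) phi D n :
  [set: M] #= `I_n -> upper_dim (team_family M D phi) <= Dim phi D n.
Proof.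
move=> Mn; apply: (@ge_supremum_nat _ #|{set {ffun D -> option 'I_n}}|).
  move=> _ [M' M'n ->]; apply: (upper_dim_coverable _).2.
  by apply: coverable_team_family M'n _ => T [].
by exists M.
Qed.

Lemma coverable_Dim (L : vocabulary) (M : model L) phi D n :
  [set: M] #= `I_n -> coverable (Dim phi D n) (team_family M D phi).
Proof.
move=> Mn; apply: coverableW (upper_dim_le_Dim phi D Mn) _.
have cov : coverable #|{set {ffun D -> option 'I_n}}| (team_family M D phi).
  by apply: coverable_team_family Mn _ => T [].
by have [] := upper_dim_coverable cov.
Qed.

(** The team of restrictions of the assignments of T to the variables in D. *)
Definition restrict_team {A : Type} (D : {fset nat}) (T : team A) : team A :=
  [set restrictf s D | s in T].

Lemma restrict_team_on {A : Type} (D0 D : {fset nat}) (T : team A) :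
  (D0 `<=` D)%fset -> team_on D T -> team_on D0 (restrict_team D0 T).
Proof.
move=> /fsubsetP D0D TD _ [s Ts <-]; apply/fsetP => x.
rewrite mem_restrictf -[x \in s]/(x \in domf s) (TD _ Ts).
by case: (boolP (x \in D0)) => //= /D0D ->.
Qed.

Lemma team_rel_restrict {A : Type} j (xs : j.-tuple nat) (D : {fset nat})
    (T : team A) :
  {subset xs <= D} -> team_rel (restrict_team D T) xs = team_rel T xs.
Proof.
move=> xsD.
have E (s : assignment A) : values (restrictf s D) xs = values s xs.
  by apply/eq_in_map => x /xsD xD; rewrite fnd_restrict xD.
apply/seteqP; split=> [a [_ [s Ts <-] sa]|a [s Ts sa]].
  by exists s => //; rewrite -sa E.
by exists (restrictf s D); [exists s | rewrite E].
Qed.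

Lemma coverable_atom (L : vocabulary) (M : model L) j (C : iso_class j)
    (xs : j.-tuple nat) (D : {fset nat}) n :
  ([fset x in (xs : seq nat)] `<=` D)%fset -> [set: M] #= `I_n ->
  coverable (Dim (Atom L C xs) [fset x in (xs : seq nat)]%fset n)
    (team_family M D (Atom L C xs)).
Proof.
set D0 := [fset x in _]%fset => D0D Mn.
have xsD0 : {subset xs <= D0} by move=> x xxs; rewrite !inE.
suff -> : team_family M D (Atom L C xs) =
    kripke1 (fun T U => team_on D T /\ U = restrict_team D0 T)
      (team_family M D0 (Atom L C xs)).
  apply: coverable_kripke1; last exact: coverable_Dim.
  move=> E dE T T' [U ET [TD UT]] TT' T'E; subst U; exists (restrict_team D0 T').
    apply: dE ET _ _ => [_ [s Ts <-]|_ [s T's <-]]; first by exists s => //; apply: TT'.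
    have [T1 [U ET1 [_ UT]] T1s] := T'E _ T's; subst U.
    by exists (restrict_team D0 T1) => //; exists s.
  by split=> // s /T'E [T1 [U _ [T1D _]] /T1D].
apply/seteqP; split=> T.
  move=> [TD CT]; exists (restrict_team D0 T) => //; split.
    exact: restrict_team_on TD.
  by rewrite /= team_rel_restrict.
by move=> [U [_ CU] [TD UT]]; split=> //; move: CU; rewrite UT /= team_rel_restrict.
Qed.

(** * Upper bound for the formulas of the logic *)

Lemma team_onS {A : Type} D (T U : team A) : T `<=` U -> team_on D U -> team_on D T.
Proof. by move=> TU UD s /TU /UD. Qed.

Lemma team_on_extend {A : Type} D r (T : team A)
    (F : assignment A -> set (r.-tuple A)) (ys : r.-tuple nat) :
  team_on D T -> team_on (D `|` [fset y in (ys : seq nat)])%fset (extend T F ys).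
Proof.
move=> TD _ [s /TD <- [b _ ->]]; rewrite /update.
have : size (ys : seq nat) = size (b : seq A) by rewrite !size_tuple.
move: (ys : seq nat) (b : seq A) => {}ys {}b.
elim: ys b => [|y ys IH] [|a b] //=; first by move=> _; apply/fsetP => x; rewrite !inE orbF.
by move=> [/IH yb]; apply/fsetP => x; rewrite !inE yb !inE orbCA.
Qed.

Lemma coverable_flat {A : Type} D (P : assignment A -> Prop) :
  coverable 1 [set T : team A | team_on D T /\ forall s, T s -> P s].
Proof.
suff -> : [set T : team A | team_on D T /\ forall s, T s -> P s] =
    [set T | T `<=` [set s | domf s = D /\ P s]].
  by apply: coverable_dc; apply: dc_family_powerset.
apply/seteqP; split=> [T [TD TP] s Ts|T /= TDP].
  by split; [exact: TD | exact: TP].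
by split=> s /TDP [].
Qed.

(** The operator on families of teams induced by a Lindstrom quantifier sends a
    dominated convex family to a dominated convex or empty one. *)
Lemma dc_family_extend {A : Type} r (K : set (set (r.-tuple A)))
    (ys : r.-tuple nat) D (E : set (team A)) : dc_family E ->
  dc_family (kripke1 (fun T U => team_on D T /\
    exists F, U = extend T F ys /\ forall s, T s -> K (F s)) E).
Proof.
move=> dE T C [U ET [TD [F [UT KF]]]] TC CE; subst U.
have /choice [G GP] s : exists B, C s ->
    K B /\ forall b, B b -> exists2 U, E U & U (update s ys b).
  have [Cs|] := pselect (C s); last by exists set0.
  have [T' [U ET' [_ [F' [UT KF']]]] T's] := CE _ Cs; subst U.
  exists (F' s) => _; split=> [|b F'b]; first exact: KF'.
  by exists (extend T' F' ys) => //; exists s => //; exists b.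
(* Keep the witness F on T, and on the rest of C use witnesses of members
   containing the assignment; the extension of C then lies between that of T
   and the union of E. *)
pose H s := if pselect (T s) then F s else G s.
exists (extend C H ys); last first.
  split=> [s /CE [T' [U _ [T'D _]] /T'D] //|].
  exists H; split=> // s Cs; rewrite /H.
  case: (pselect (T s)) => [Ts|nTs] /=; first exact: KF.
  by have [] := GP s Cs.
apply: (dE _ _ ET) => [t [s Ts [b Fb ->]]|t [s Cs [b Hb ->]]].
  by exists s; [exact: TC | exists b => //; rewrite /H; case: (pselect (T s))].
move: Hb; rewrite /H; case: (pselect (T s)) => [Ts|nTs] /= Hb.
  by exists (extend T F ys) => //; exists s => //; exists b.
by have [_] := GP s Cs; apply.
Qed.

Lemma team_family_And (L : vocabulary) (M : model L) D p q :
  team_family M D (And p q) =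
  kripke2 (fun T U V => T = U /\ T = V) (team_family M D p) (team_family M D q).
Proof.
apply/seteqP; split=> T; first by move=> [TD [pT qT]]; exists T, T.
by move=> [U [V [[UD pU] [VD qV] [TU TV]]]]; subst U V.
Qed.

Lemma team_family_Or (L : vocabulary) (M : model L) D p q :
  team_family M D (Or p q) =
  kripke2 (fun T U V => T = U `|` V) (team_family M D p) (team_family M D q).
Proof.
apply/seteqP; split=> T.
  move=> [TD [U [V [TUV pU qV]]]]; subst T; exists U, V; split=> //; split=> //.
    by apply: team_onS TD; exact: subsetUl.
  by apply: team_onS TD; exact: subsetUr.
move=> [U [V [[UD pU] [VD qV] ->]]]; split; last by exists U, V.
by move=> s [/UD|/VD].
Qed.

Lemma team_family_Tensor (L : vocabulary) (M : model L) D p q :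
  team_family M D (Tensor p q) =
  kripke2 (fun T U V => T = U `&` V) (team_family M D p) (team_family M D q).
Proof.
apply/seteqP; split=> T.
  by move=> [TD [U [V [[UD VD] TUV pU qV]]]]; exists U, V.
move=> [U [V [[UD pU] [VD qV] ->]]]; split; last by exists U, V.
by move=> s [/UD].
Qed.

Lemma team_family_IOr (L : vocabulary) (M : model L) D p q :
  team_family M D (IOr p q) = team_family M D p `|` team_family M D q.
Proof.
apply/seteqP; split=> T; first by move=> [TD [pT|qT]]; [left | right].
by move=> [[TD pT]|[TD qT]]; split=> //; [left | right].
Qed.

Lemma team_family_Quant (L : vocabulary) (M : model L) D r
    (K : iso_class r.+1) (ys : r.+1.-tuple nat) (Uys : uniq ys) p :
  team_family M D (Quant K Uys p) =
  kripke1 (fun T U => team_on D T /\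
             exists F, U = extend T F ys /\ forall s, T s -> K M (F s))
    (team_family M (D `|` [fset y in (ys : seq nat)])%fset p).
Proof.
apply/seteqP; split=> T.
  move=> [TD [F [pF KF]]]; exists (extend T F ys); last by split=> //; exists F.
  by split=> //; exact: team_on_extend.
by move=> [U [_ pU] [TD [F [UF KF]]]]; subst U; split=> //; exists F.
Qed.

(** The bound is uniform in the domain D, as needed in the quantifier case,
    where the domain grows. *)
Theorem coverable_logic_upper (G : set (nat -> nat)) (b : nat -> nat) (k : nat)
    (L : vocabulary) (phi : formula L) :
  (forall n, 2 <= n -> 2 <= b n) ->
  (forall f, G f -> exists c, forall n, 2 <= n -> f n <= b n ^ (c * n ^ k)) ->
  logic_upper G phi ->
  exists c, forall (M : model L) D n, 2 <= n -> [set: M] #= `I_n ->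
    (free_vars phi `<=` D)%fset ->
    coverable (b n ^ (c * n ^ k)) (team_family M D phi).
Proof.
move=> b2 Gc; have b0 n m : 2 <= n -> 0 < b n ^ m.
  by move=> n2; rewrite expn_gt0 (leq_trans _ (b2 n n2)).
have mulc n c d : b n ^ (c * n ^ k) * b n ^ (d * n ^ k) = b n ^ ((c + d) * n ^ k).
  by rewrite -expnD mulnDl.
elim=> {phi} [t u|t u|R ts|R ts|j C xs|p q _ [c IHp] _ [d IHq]
    |p q _ [c IHp] _ [d IHq]|p q _ [c IHp] _ [d IHq]|p q _ [c IHp] _ [d IHq]
    |r K ys Uys p _ [c IHp]].
- exists 0 => M D n n2 _ _; apply: coverableW (b0 n _ n2) _.
  exact: (coverable_flat D
    (fun s => exists a b, [/\ term_val s t a, term_val s u b & a = b])).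
- exists 0 => M D n n2 _ _; apply: coverableW (b0 n _ n2) _.
  exact: (coverable_flat D
    (fun s => exists a b, [/\ term_val s t a, term_val s u b & a <> b])).
- exists 0 => M D n n2 _ _; apply: coverableW (b0 n _ n2) _.
  exact: (coverable_flat D (fun s => exists2 a, args_val s ts a & rel_int a)).
- exists 0 => M D n n2 _ _; apply: coverableW (b0 n _ n2) _.
  exact: (coverable_flat D (fun s => exists2 a, args_val s ts a & ~ rel_int a)).
- move=> /Gc [c Dimc]; exists c => M D n n2 Mn CD; apply: coverableW (Dimc n n2) _.
  exact: coverable_atom.
- exists (c + d) => M D n n2 Mn /=; rewrite fsubUset => /andP [pD qD].
  rewrite team_family_And -mulc; apply: coverable_kripke2; [|exact: IHp|exact: IHq].
  exact: dc_familyI.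
- exists (c + d) => M D n n2 Mn /=; rewrite fsubUset => /andP [pD qD].
  rewrite team_family_Or -mulc; apply: coverable_kripke2; [|exact: IHp|exact: IHq].
  exact: dc_family_setU.
- exists (c + d) => M D n n2 Mn /=; rewrite fsubUset => /andP [pD qD].
  rewrite team_family_Tensor -mulc; apply: coverable_kripke2; [|exact: IHp|exact: IHq].
  exact: dc_family_setI.
(* The sum of the two bounds is at most twice their product, and 2 is at most
   b n ^ n ^ k; hence the additional summand 1. *)
- exists (c + d + 1) => M D n n2 Mn /=; rewrite fsubUset => /andP [pD qD].
  rewrite team_family_IOr.
  apply: coverableW (coverableU (IHp _ _ _ n2 Mn pD) (IHq _ _ _ n2 Mn qD)).
  rewrite -2!mulc mul1n.
  have : 2 <= b n ^ n ^ k.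
    apply: leq_trans (b2 n n2) _; rewrite -{1}[b n]expn1 leq_exp2l ?b2 //.
    by rewrite expn_gt0 (leq_trans _ n2).
  have := b0 n (c * n ^ k) n2; have := b0 n (d * n ^ k) n2.
  move: (b n ^ (c * n ^ k)) (b n ^ (d * n ^ k)) (b n ^ n ^ k) => x y z.
  move=> y0 x0 z2; apply: (@leq_trans (x * y * 2)); last by rewrite leq_mul2l z2 orbT.
  by nia.
- exists c => M D n n2 Mn /= pD; rewrite team_family_Quant.
  apply: coverable_kripke1; first exact: dc_family_extend.
  by apply: IHp => //; rewrite fsetUC -fsubDset.
Qed.

Lemma horner_nat_leq (p : {poly nat}) k : size p = k.+1 ->
  exists c, forall n, 0 < n -> (p.[n]%R : nat) <= c * n ^ k.
Proof.
move=> sp; exists (\sum_(i < size p) nth 0 p i) => n n0.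
rewrite horner_coef big_distrl /=.
elim/big_ind2: _ => // [x1 x2 y1 y2|i _]; first by rewrite natrE; apply: leq_add.
rewrite !natrE leq_mul2l leq_pexp2l ?orbT //.
by rewrite -ltnS -sp.
Qed.

Lemma growthE_leq k f : growthE k f ->
  exists c, forall n, 2 <= n -> f n <= 2 ^ (c * n ^ k).
Proof.
move=> [p /horner_nat_leq [c pc] fp]; exists c => n n2.
apply: leq_trans (fp n) _; rewrite leq_exp2l //; apply: pc.
exact: leq_trans n2.
Qed.

Lemma growthF_leq k f : growthF k f ->
  exists c, forall n, 2 <= n -> f n <= n ^ (c * n ^ k).
Proof.
move=> [p /horner_nat_leq [c pc] fp]; exists c => n n2.
apply: leq_trans (fp n n2) _; rewrite leq_exp2l //; apply: pc.
exact: leq_trans n2.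
Qed.

Lemma ord0_neq_max n : (ord0 : 'I_n.+2) <> ord_max.
Proof. by move/(congr1 val). Qed.

(** A model on n + 2 elements for an arbitrary vocabulary: empty relations and
    constant functions. *)
Definition trivial_model (L : vocabulary) (n : nat) : model L :=
  @Model L 'I_n.+2 (fun=> set0) (fun _ _ => ord0)
    (ex_intro _ ord0 (ex_intro _ ord_max (@ord0_neq_max n))).

(** The family of the teams of domain zs with the property alpha. *)
Definition subteams {A : Type} (zs : seq nat) (alpha : team A -> Prop) :
    set (team A) :=
  [set T | team_on [fset z in zs]%fset T /\ alpha T].

(** An atom whose families of teams on some finite models cannot be covered
    within the growth bound is not definable. *)
Lemma not_definable_logic_upper (G : set (nat -> nat)) (b : nat -> nat) (k : nat)
    (L : vocabulary) (zs : seq nat) (alpha : forall A : Type, team A -> Prop) :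
  (forall n, 2 <= n -> 2 <= b n) ->
  (forall f, G f -> exists c, forall n, 2 <= n -> f n <= b n ^ (c * n ^ k)) ->
  (forall c, exists2 n : nat, 2 <= n & forall N,
     coverable N (subteams zs (alpha 'I_n)) ->
     b n ^ (c * n ^ k) < N) ->
  ~ definable (@logic_upper G L) zs alpha.
Proof.
move=> b2 Gc low [phi [/(coverable_logic_upper b2 Gc) [c covphi] fvphi phiP]].
have [[|[|n]] // _ /(_ (b n.+2 ^ (c * n.+2 ^ k)))] := low c.
rewrite ltnn => ncov; have /ncov // : coverable (b n.+2 ^ (c * n.+2 ^ k))
  (subteams zs (alpha 'I_n.+2)).
have /(_ (trivial_model L n)) := phiP; rewrite /= => {}phiP.
have -> : subteams zs (alpha 'I_n.+2) =
    team_family (trivial_model L n) [fset z in zs]%fset phi.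
  by apply/seteqP; split=> T [TD] /(phiP T TD).
apply: (covphi (trivial_model L n)) fvphi => //.
by rewrite card_eq_sym; exact: card_II.
Qed.

(** * Lower bounds for the atoms *)

Lemma values_cat {A : Type} (s : assignment A) (xs ys : seq nat) :
  values s (xs ++ ys) = values s xs ++ values s ys.
Proof. exact: map_cat. Qed.

Lemma some_inj {A : Type} : injective (@Some A).
Proof. by move=> a b []. Qed.

Lemma map_some_tuple_inj {A : Type} k (u v : k.-tuple A) :
  map some u = map some v -> u = v.
Proof. by move/(inj_map (@some_inj A))/val_inj. Qed.

Lemma assignment_exists {A : Type} (zs : seq nat) (v : seq A) :
  uniq zs -> size v = size zs ->
  exists s : assignment A, domf s = [fset z in zs]%fset /\ values s zs = map some v.
Proof.
case: v => [|a v'] Uzs sz.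
  exists [fmap]%fmap; case: zs Uzs sz => // _ _; split=> //.
  by apply/fsetP => x; rewrite !inE.
move: (a :: v') sz => v sz.
exists [fmap x : [fset z in zs]%fset => nth a v (index (val x) zs)]%fmap.
split=> //; apply: (@eq_from_nth _ None); first by rewrite !size_map.
move=> i; rewrite size_map => ilt.
rewrite (nth_map 0) // (nth_map a) ?sz //.
have zi : nth 0 zs i \in [fset z in zs]%fset by rewrite inE mem_nth.
by rewrite (in_fnd zi) ffunE /= index_uniq.
Qed.

Lemma assignment_exists2 {A : Type} (xs ys : seq nat) (a b : seq A) :
  uniq (xs ++ ys) -> size a = size xs -> size b = size ys ->
  exists s : assignment A, [/\ domf s = [fset z in xs ++ ys]%fset,
    values s xs = map some a & values s ys = map some b].
Proof.
move=> U sa sb; have [|s [sD]] := @assignment_exists A _ (a ++ b) U.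
  by rewrite !size_cat sa sb.
rewrite values_cat map_cat => E; exists s; split=> //.
  have := congr1 (take (size xs)) E.
  by rewrite !take_size_cat ?size_map.
have := congr1 (drop (size xs)) E.
by rewrite !drop_size_cat ?size_map.
Qed.

Lemma values_total {A : Type} (s : assignment A) k (xs : k.-tuple nat) :
  {subset xs <= domf s} -> exists a : k.-tuple A, values s xs = map some a.
Proof.
move=> xsD; suff [a sa] : exists a, values s xs = map some a.
  have /eqP sza : size a = k by rewrite -(size_map some) -sa size_map size_tuple.
  by exists (Tuple sza).
have {}xsD : {subset tval xs <= domf s} by [].
elim: (tval xs) xsD => [|x ys IH] xsD; first by exists [::].
have [|a sa] := IH; first by move=> y yys; apply: xsD; rewrite inE yys orbT.
have xD : x \in domf s by apply: xsD; rewrite inE eqxx.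
by exists (s.[xD]%fmap :: a); rewrite /= -sa (in_fnd xD).
Qed.

(** The assignments whose tuple of values at xs is defined and belongs to P. *)
Definition vals_in {A : finType} k (xs : k.-tuple nat) (P : {set k.-tuple A}) :
    set (assignment A) :=
  [set s | exists2 t : k.-tuple A, t \in P & values s xs = map some t].

Lemma vals_inE {A : finType} k (xs : k.-tuple nat) (P : {set k.-tuple A}) s
    (t : k.-tuple A) :
  values s xs = map some t -> vals_in xs P s <-> t \in P.
Proof.
move=> st; split=> [[u uP]|tP]; last by exists t.
by rewrite st => /map_some_tuple_inj ->.
Qed.

Definition const_tuple {A : Type} k (a : A) : k.-tuple A := [tuple of nseq k a].

Lemma const_tuple_neq {A : eqType} k (a0 a1 : A) :
  a0 != a1 -> const_tuple k.+1 a0 != const_tuple k.+1 a1.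
Proof. by move=> a01; apply/eqP => /(congr1 val) [] /eqP; rewrite (negbTE a01). Qed.

(** The subtraction of 2 accounts for the tuple of a0s, which is put in all the
    sets of tuples considered, and for that of a1s, which is put in none. *)
Lemma exclusion_lower {A : finType} (a0 a1 : A) k (xs ys : k.+1.-tuple nat) N :
  a0 != a1 -> uniq (xs ++ ys) ->
  coverable N (subteams (xs ++ ys) (@exclusion xs ys A)) ->
  2 ^ (#|A| ^ k.+1 - 2) <= N.
Proof.
move=> a01 U cov; set p0 := const_tuple k.+1 a0; set p1 := const_tuple k.+1 a1.
have p01 : p0 != p1 := const_tuple_neq k a01.
have cardZ : #|~: [set p0; p1]| = #|A| ^ k.+1 - 2.
  by rewrite cardsCs finset.setCK cards2 p01 card_tuple.
pose S (P : {set k.+1.-tuple A}) : team A :=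
  [set s | [/\ domf s = [fset z in xs ++ ys]%fset,
    vals_in xs (p0 |: P) s & vals_in ys (~: (p0 |: P)) s]].
have SP (P : {set k.+1.-tuple A}) (a b : k.+1.-tuple A) :
    a \in p0 |: P -> b \notin p0 |: P ->
    exists2 s, S P s & values s xs = map some a /\ values s ys = map some b.
  move=> aP bP; have [||s [sD sa sb]] :=
    @assignment_exists2 A xs ys a b U;
    rewrite ?size_tuple //.
  exists s => //; split=> //; first by apply/(vals_inE _ sa).
  by apply/(vals_inE _ sb); rewrite finset.inE.
rewrite -cardZ; apply: (fooling_subsets (S := S) cov) => [P PZ|P Q q PZ QZ qQ qP sub].
  split=> [s [] //|s s' [_ [a aP sa] _] [_ _ [b bP sb]]].
  by rewrite sa sb => /map_some_tuple_inj ab; move: bP; rewrite -ab finset.inE aP.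
have := fintype.subsetP QZ q qQ; rewrite !finset.inE negb_or => /andP [q0 q1].
have [|_] := sub (S P `|` S Q); first by split=> //; exact: subsetUl.
have p1Q : p1 \notin p0 |: Q.
  rewrite !finset.inE negb_or eq_sym p01 /=; apply/negP => /(fintype.subsetP QZ).
  by rewrite !finset.inE eqxx orbT.
have [|s Ss [sq _]] := SP Q q p1 _ p1Q; first by rewrite !finset.inE qQ orbT.
have [||s' Ss' [_ s'q]] := SP P p0 q; first by rewrite !finset.inE eqxx.
  by rewrite !finset.inE negb_or q0.
by move=> /(_ s s' (or_intror Ss) (or_introl Ss')); rewrite sq s'q; apply.
Qed.

(** The subtraction of 1 accounts for the tuple of a0s, which is put in all the
    sets of tuples considered. *)
Lemma inclusion_lower {A : finType} (a0 a1 : A) k (xs ys : k.+1.-tuple nat) N :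
  a0 != a1 -> uniq (xs ++ ys) ->
  coverable N (subteams (xs ++ ys) (@inclusion xs ys A)) ->
  2 ^ (#|A| ^ k.+1 - 1) <= N.
Proof.
move=> a01 U cov; set p0 := const_tuple k.+1 a0.
have cardZ : #|[set~ p0]%SET| = #|A| ^ k.+1 - 1.
  by rewrite cardsC1 card_tuple subn1.
pose S (P : {set k.+1.-tuple A}) : team A :=
  [set s | [/\ domf s = [fset z in xs ++ ys]%fset,
    vals_in xs (p0 |: P) s & vals_in ys (p0 |: P) s]].
have SP (P : {set k.+1.-tuple A}) (a b : k.+1.-tuple A) :
    a \in p0 |: P -> b \in p0 |: P ->
    exists2 s, S P s & values s xs = map some a /\ values s ys = map some b.
  move=> aP bP; have [||s [sD sa sb]] :=
    @assignment_exists2 A xs ys a b U;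
    rewrite ?size_tuple //.
  exists s => //; split=> //; first by apply/(vals_inE _ sa).
  exact/(vals_inE _ sb).
rewrite -cardZ; apply: (fooling_subsets (S := S) cov) => [P PZ|P Q q PZ QZ qQ qP sub].
  split=> [s [] //|s [_ [a aP sa] _]].
  by have [s' Ss' [_ s'a]] := SP P a a aP aP; exists s' => //; rewrite sa s'a.
have := fintype.subsetP QZ q qQ; rewrite !finset.inE => q0.
(* The team of P, extended by one assignment with values q at xs and p0 at ys,
   has no assignment with values q at ys. *)
have [||s Ss [sq sp]] := SP Q q p0; [by rewrite !finset.inE ?qQ ?eqxx ?orbT..|].
have [|_] := sub (S P `|` [set s]).
  by split; [exact: subsetUl | move=> t [St|->]; [left | right]].
move=> /(_ s (or_intror erefl)) [s' [[_ _ [b bP s'b]]|->]]; rewrite sq.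
  rewrite s'b => /map_some_tuple_inj qb; move: bP; rewrite -qb !finset.inE.
  by rewrite (negbTE q0) (negbTE qP).
by rewrite sp => /map_some_tuple_inj /eqP; rewrite (negbTE q0).
Qed.

Lemma anonymity_lower {A : finType} (a0 a1 : A) k (xs : k.-tuple nat) (y : nat) N :
  a0 != a1 -> uniq (rcons xs y) ->
  coverable N (subteams (rcons xs y) (@anonymity xs y A)) ->
  2 ^ (#|A| ^ k) <= N.
Proof.
rewrite -cats1 => a01 U cov.
pose S (P : {set k.-tuple A}) : team A :=
  [set s | domf s = [fset z in xs ++ [:: y]]%fset /\ vals_in xs P s].
have SP (P : {set k.-tuple A}) (a : k.-tuple A) (b : A) : a \in P ->
    exists2 s, S P s & values s xs = map some a /\ fnd s y = Some b.
  move=> aP; have [||s [sD sa [sb]]] :=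
    @assignment_exists2 A xs [:: y] a [:: b] U;
    rewrite ?size_tuple //.
  by exists s => //; split=> //; apply/(vals_inE _ sa).
rewrite -(card_tuple k A) -cardsT.
apply: (fooling_subsets (S := S) cov) => [P PZ|P Q q PZ QZ qQ qP sub].
  split=> [s [] //|s [_ [a aP sa]]].
  pose b := if fnd s y == Some a0 then a1 else a0.
  have [s' Ss' [s'a s'b]] := SP P a b aP; exists s' => //; rewrite sa s'a s'b; split=> //.
  rewrite /b; case: eqP => [->|//] [] /eqP; exact/negP.
(* The new assignment is the only one with values q at xs. *)
have [s Ss [sq sb]] := SP Q q a0 qQ.
have [|_] := sub (S P `|` [set s]).
  by split; [exact: subsetUl | move=> t [St|->]; [left | right]].
move=> /(_ s (or_intror erefl)) [s' [[_ [b bP s'b]]|->]] [] //.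
by rewrite sq s'b => /map_some_tuple_inj qb; move: bP; rewrite -qb (negbTE qP).
Qed.

Lemma dependence_lower {A : finType} k (xs : k.-tuple nat) (y : nat) N : uniq (rcons xs y) ->
  coverable N (subteams (rcons xs y) (@dependence xs y A)) ->
  #|A| ^ (#|A| ^ k) <= N.
Proof.
rewrite -cats1 => U cov.
pose S (f : {ffun k.-tuple A -> A}) : team A :=
  [set s | domf s = [fset z in xs ++ [:: y]]%fset /\
    exists2 a : k.-tuple A, values s xs = map some a & fnd s y = Some (f a)].
rewrite -(card_tuple k A) -card_ffun; apply: (fooling_leq (S := S) cov) => [f|f g sub _].
  split=> [s [] //|s s' [_ [a sa sfa]] [_ [b s'b s'fb]]].
  by rewrite sa s'b => /map_some_tuple_inj ab; rewrite sfa s'fb ab.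
have [|_ dep] := sub (S f `|` S g); first by split=> //; exact: subsetUl.
apply/ffunP => a.
have Sf (h : {ffun k.-tuple A -> A}) :
    exists2 s, S h s & values s xs = map some a /\ fnd s y = Some (h a).
  have [||s [sD sa [sb]]] :=
    @assignment_exists2 A xs [:: y] a [:: h a] U;
    rewrite ?size_tuple //.
  by exists s => //; split=> //; exists a.
have [s Ss [sa sfa]] := Sf f; have [s' Ss' [s'a s'ga]] := Sf g.
have := dep s s' (or_introl Ss) (or_intror Ss').
by rewrite sa s'a sfa s'ga => /(_ erefl) [].
Qed.

(** The k-tuple of a0s is allowed at t2 together with every m-tuple at t1, which
    leaves n ^ m * (n ^ k - 1) free pairs on a model of size n. *)
Lemma independence_lower {A : finType} (a0 a1 : A) k l m (t1 : m.-tuple nat)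
    (t2 : k.-tuple nat) (t3 : l.+1.-tuple nat) N :
  a0 != a1 -> uniq (t1 ++ t2 ++ t3) ->
  coverable N (subteams (t1 ++ t2 ++ t3) (@independence t2 t1 t3 A)) ->
  2 ^ (#|A| ^ m * (#|A| ^ k - 1)) <= N.
Proof.
move=> a01 U cov; set p0 := const_tuple k a0.
pose Z : {set m.-tuple A * k.-tuple A} := finset.setX finset.setT [set~ p0]%SET.
have cardZ : #|Z| = #|A| ^ m * (#|A| ^ k - 1).
  by rewrite cardsX cardsT cardsC1 !card_tuple subn1.
pose S (P : {set m.-tuple A * k.-tuple A}) : team A :=
  [set s | domf s = [fset z in t1 ++ t2 ++ t3]%fset /\
    exists (c : m.-tuple A) (a : k.-tuple A), [/\ ((c, a) \in P) || (a == p0),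
      values s t1 = map some c & values s t2 = map some a]].
have SP (P : {set m.-tuple A * k.-tuple A}) c a (e : l.+1.-tuple A) :
    ((c, a) \in P) || (a == p0) -> exists2 s, S P s & [/\ values s t1 = map some c,
      values s t2 = map some a & values s t3 = map some e].
  move=> caP; have [||s [sD sc]] :=
    @assignment_exists2 A t1 (t2 ++ t3) c (a ++ e) U;
    rewrite ?size_cat ?size_tuple //.
  rewrite values_cat map_cat => /eqP; rewrite eqseq_cat ?size_map ?size_tuple //.
  move=> /andP [/eqP sa /eqP se].
  by exists s => //; split=> //; exists c, a.
rewrite -cardZ; apply: (fooling_subsets (S := S) cov) => [P PZ|P Q [c a] PZ QZ qQ qP sub].
  split=> [s [] //|s s' [_ [c [a [caP sc sa]]]] [s'D _] ss'].
  have [|e s'e] := @values_total A s' _ t3.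
    by move=> x xt3; rewrite s'D !inE xt3 !orbT.
  have [s'' Ss'' [s''c s''a s''e]] := SP P c a e caP.
  by exists s'' => //; split; rewrite ?s''c ?s''a ?s''e.
have := fintype.subsetP QZ _ qQ; rewrite !finset.inE /= => a_p0.
(* The values of s at t1 ++ t2 do not occur in the team of P, so s alone cannot
   realize them together with the values of s' at t3. *)
have [|s Ss [sc sa se]] := SP Q c a (const_tuple l.+1 a0); first by rewrite qQ.
have [|s' Ss' [s'c s'a s'e]] := SP P c p0 (const_tuple l.+1 a1); first by rewrite eqxx orbT.
have [|_] := sub (S P `|` [set s]).
  by split; [exact: subsetUl | move=> t [St|->]; [left | right]].
move=> /(_ s s' (or_intror erefl) (or_introl Ss')); rewrite sc s'c => /(_ erefl).
move=> [s'' [[_ [c' [a' [caP s''c s''a]]]]|->]] [] .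
  rewrite s''c s''a sa => /map_some_tuple_inj cc /map_some_tuple_inj aa _.
  by move: caP; rewrite cc aa (negbTE qP) (negbTE a_p0).
by rewrite se s'e => _ _ /map_some_tuple_inj /eqP; rewrite (negbTE (const_tuple_neq l a01)).
Qed.

(** * Growth comparison and conclusion *)

Lemma expn_growth c k : c * c.+3 ^ k < c.+3 ^ k.+1 - 2.
Proof.
have : 0 < c.+3 ^ k by rewrite expn_gt0.
by rewrite expnS; move: (c.+3 ^ k) => x x0; nia.
Qed.

Lemma tower_growth c i m k : 0 < k -> i < k + m -> exists2 n, 2 <= n &
  n ^ (c * n ^ i) < 2 ^ (n ^ m * (n ^ k - 1)).
Proof.
(* With n = 2 ^ t the left-hand side is 2 ^ (t * c * n ^ i), and since i < k + m
   it is enough that 2 * t * c < 2 ^ t; this holds for t = 2 * (4 * c + 1). *)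
move=> k0 ikm; pose u := 4 * c + 1; pose n := 2 ^ (2 * u).
have n2 : 2 <= n by rewrite /n -{1}[2]expn1 leq_exp2l //; lia.
have cn : 4 * c * u < n.
  have := ltn_expl u (isT : 1 < 2); rewrite /n mul2n -addnn expnD.
  by move: (2 ^ u) => x; nia.
exists n => //; rewrite {1}/n -expnM ltn_exp2l //.
have ni : n * n ^ i <= n ^ m * n ^ k.
  by rewrite -expnS -expnD leq_exp2l // addnC.
have nk : 2 <= n ^ k by apply: (leq_trans n2); rewrite -{1}[n]expn1 leq_exp2l.
have ni0 : 0 < n ^ i by rewrite expn_gt0 (leq_trans _ n2).
have lt : 4 * c * u * n ^ i < n * n ^ i by rewrite ltn_pmul2r.
have half : n ^ m * n ^ k <= n ^ m * (n ^ k - 1) * 2.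
  by rewrite -mulnA leq_mul2l; apply/orP; right; lia.
by rewrite mulnA; lia.
Qed.

Lemma independence_sym (t2 t1 t3 : seq nat) (A : Type) (T : team A) :
  independence t2 t1 t3 T -> independence t3 t1 t2 T.
Proof.
move=> ind s s' Ts T's ss'.
by have [s'' Ts'' [e1 e2 e3]] := ind s' s T's Ts (esym ss'); exists s'' => //; split; rewrite ?ss'.
Qed.

Lemma independence_not_definable (L : vocabulary) k l m i (t1 : m.-tuple nat)
    (t2 : k.-tuple nat) (t3 : l.-tuple nat) :
  0 < k -> 0 < l -> uniq (t1 ++ t2 ++ t3) -> i < k + m ->
  ~ definable (@LFU i L) (t1 ++ t2 ++ t3) (independence t2 t1 t3).
Proof.
case: l t3 => // l t3 k0 _ U ikm.
apply: (not_definable_logic_upper (b := id)) (@growthF_leq i) _ => // c.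
have [[|[|n]] // n2 lt] := tower_growth c k0 ikm.
exists n.+2 => // N /(independence_lower (introN eqP (@ord0_neq_max n)) U).
by rewrite card_ord; apply: leq_trans.
Qed.

Theorem theorem5p6 (L : vocabulary) :
  [/\ forall k : nat,
        [/\ forall xs ys : k.+1.-tuple nat, uniq (xs ++ ys) ->
              ~ definable (@LEU k L) (xs ++ ys) (inclusion xs ys),
            forall (xs : k.+1.-tuple nat) (y : nat), uniq (rcons xs y) ->
              ~ definable (@LEU k L) (rcons xs y) (anonymity xs y)
          & forall xs ys : k.+1.-tuple nat, uniq (xs ++ ys) ->
              ~ definable (@LEU k L) (xs ++ ys) (exclusion xs ys)],
      forall (k : nat) (xs : k.+1.-tuple nat) (y : nat), uniq (rcons xs y) ->
        ~ definable (@LFU k L) (rcons xs y) (dependence xs y)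
    & forall (k l m i : nat)
        (t1 : m.-tuple nat) (t2 : k.-tuple nat) (t3 : l.-tuple nat),
        1 <= k -> 1 <= l -> uniq (t1 ++ t2 ++ t3) -> i < maxn k l + m ->
        ~ definable (@LFU i L) (t1 ++ t2 ++ t3) (independence t2 t1 t3)].
Proof.
split=> [k|k xs y U|k l m i t1 t2 t3 k0 l0 U].
- have a01 c : (ord0 : 'I_c.+3) != ord_max := introN eqP (@ord0_neq_max _).
  split=> [xs ys U|xs y U|xs ys U];
    apply: (not_definable_logic_upper (b := fun=> 2)) (@growthE_leq k) _ => // c;
    exists c.+3 => // N.
  + move=> /(inclusion_lower (a01 c) U); apply: leq_trans.
    rewrite card_ord ltn_exp2l //.
    by have := expn_growth c k; lia.
  + move=> /(anonymity_lower (a01 c) U); apply: leq_trans.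
    rewrite card_ord ltn_exp2l //.
    by have := expn_growth c k; lia.
  + move=> /(exclusion_lower (a01 c) U); apply: leq_trans.
    rewrite card_ord ltn_exp2l //.
    by have := expn_growth c k; lia.
- apply: (not_definable_logic_upper (b := id)) (@growthF_leq k) _ => // c.
  exists c.+3 => // N /(dependence_lower U).
  rewrite card_ord; apply: leq_trans; rewrite ltn_exp2l //.
  by have := expn_growth c k; lia.
- rewrite /maxn; case: (ltnP k l) => _ im; last exact: independence_not_definable.
  have t23 : perm_eq (t1 ++ t2 ++ t3) (t1 ++ t3 ++ t2) by rewrite perm_cat2l perm_catC.
  move=> [phi [phiL fv phiP]].
  have zsE : [fset z in t1 ++ t2 ++ t3]%fset = [fset z in t1 ++ t3 ++ t2]%fset.
    by apply/fsetP => z; rewrite !inE orbA orbAC -orbA.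
  apply: (@independence_not_definable L l k m i t1 t3 t2) => //.
    by rewrite -(perm_uniq t23).
  exists phi; rewrite -zsE; split=> // M T TD.
  have [ind_phi phi_ind] := phiP M T TD.
  by split=> [/independence_sym/ind_phi|/phi_ind/independence_sym].
Qed.
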